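(* Let $n\in\mathbb{N}$ and let $\delta$ be a positive infinitesimal in ${}^*\mathbb{R}$. Suppose that $D$ is a directed set and that $d\in D\mapsto[f^d]$ is a $D$-net in $\mathcal{G}^0$ that converges to $[g]\in\mathcal{G}$ in the topology $\tau^\delta$. Then $[g]\in\mathcal{G}^0$.
   Context: A sufficiently saturated nonstandard extension $X\mapsto{}^*X$ (at least an enlargement) is fixed. $\mathcal{G}=\mathcal{G}_{n,1}$ is the ring of germs at $0$ of arbitrary functions $f:(\mathbb{R}^n,0)\to(\mathbb{R},0)$ (defined on a neighborhood of $0$, $f(0)=0$), and $\mathcal{G}^0\subset\mathcal{G}$ is the subring of germs of functions continuous on a neighborhood of $0$. For real $r>0$, $\|f\|_r=\sup\{|f(x)|:|x|\le r\}$, and ${}^*\|f\|_\delta$ is the value at $\delta$ of the transfer of $r\mapsto\|f\|_r$, i.e. the internal supremum of $|{}^*f|$ on $B_\delta=\{\xi\in{}^*\mathbb{R}^n:|\xi|\le\delta\}$. $\mathcal{M}$ is the set of germs at $0$ of functions $m:\mathbb{R}_+\to\mathbb{R}_+$ with $\lim_{t\to0}m(t)=0$ and $m(r)<m(t)$ for all sufficiently small $0<r<t$. $\mathcal{N}_\delta=\{{}^*m(\delta):[m]\in\mathcal{M}\}$ (equivalently, the set of ${}^*\|g\|_\delta$ with $[g]\in\mathcal{G}$, $\|g\|_r\to0$ as $r\to0$, and $\|g\|_r<\|g\|_s$ for all sufficiently small $0<r<s$). For $\mathfrak r\in\mathcal{N}_\delta$, $U^\delta_{\mathfrak r}=\{[f]\in\mathcal{G}:{}^*\|f\|_\delta<\mathfrak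 r\}$. $\tau^\delta$ is the topology on $\mathcal{G}$ generated by the subbase of all translates $U^\delta_{\mathfrak r}+[f]$, $\mathfrak r\in\mathcal{N}_\delta$, $[f]\in\mathcal{G}$. *)

(* Defs.v *)
From HB Require Import structures.
From mathcomp Require Import all_boot all_order all_algebra.
From mathcomp Require Import all_classical all_reals all_analysis.

Set Implicit Arguments.
Unset Strict Implicit.
Unset Printing Implicit Defensive.

Import Order.TTheory GRing.Theory Num.Theory.
Import numFieldNormedType.Exports.

Local Open Scope classical_set_scope.
Local Open Scope ring_scope.

(** * Nonstandard extensions

   The sorts of the language are all types X; formulas are built from equality
   and membership, every object x : X is a constant, every f : X -> Y a function
   symbol.  A [universe] interprets the sort X by a type [carrier X].  Since
   [set X] and [X * Y] are sorts too, quantifiers over sets, relations and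
   functions are available and range over internal objects; quantifiers bounded
   by a set A are relativised with [FMem _ (TCst A)].

   [set] and the structures of the library are not universe polymorphic, and they
   are used on sorts.  A type [set (carrier X)] would force [carrier X] to live in
   the universe of the sorts, whereas an ultrapower that is an enlargement needs
   an index set larger than every sort; subsets of [carrier X] are therefore
   written [carrier X -> Prop]. *)

Record universe := Universe {
  carrier :> Type -> Type;
  std : forall X : Type, X -> carrier X;
  star_app : forall X Y : Type, (X -> Y) -> carrier X -> carrier Y;
  star_pair : forall X Y : Type, carrier X -> carrier Y -> carrier (X * Y)%type;
  star_mem : forall X : Type, carrier X -> carrier (set X) -> Prop }.

Definition standard_universe : universe :=
  @Universe (fun X => X) (fun X x => x) (fun X Y f x => f x)
    (fun X Y x y => (x, y)) (fun X x A => A x).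

(* Well-sorted de Bruijn indices: [var G X] is a variable of sort X in the
   context G. *)
Inductive var : seq Type -> Type -> Type :=
| VarZ (G : seq Type) (X : Type) : var (X :: G) X
| VarS (G : seq Type) (X Y : Type) : var G X -> var (Y :: G) X.

Inductive term (G : seq Type) : Type -> Type :=
| TVar (X : Type) : var G X -> term G X
| TCst (X : Type) : X -> term G X
| TApp (X Y : Type) : (X -> Y) -> term G X -> term G Y
| TPair (X Y : Type) : term G X -> term G Y -> term G (X * Y)%type.

Inductive formula : seq Type -> Type :=
| FEq (G : seq Type) (X : Type) : term G X -> term G X -> formula G
| FMem (G : seq Type) (X : Type) : term G X -> term G (set X) -> formula G
| FNot (G : seq Type) : formula G -> formula G
| FAnd (G : seq Type) : formula G -> formula G -> formula G
| FOr (G : seq Type) : formula G -> formula G -> formula G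
| FImp (G : seq Type) : formula G -> formula G -> formula G
| FAll (G : seq Type) (X : Type) : formula (X :: G) -> formula G
| FEx (G : seq Type) (X : Type) : formula (X :: G) -> formula G.

Fixpoint env (U : universe) (G : seq Type) : Type :=
  if G is X :: G' then (U X * env U G')%type else unit.

Fixpoint lookup (U : universe) (G : seq Type) (X : Type) (v : var G X) :
    env U G -> U X :=
  match v with
  | VarZ _ _ => fun e => e.1
  | VarS _ _ _ v' => fun e => lookup v' e.2
  end.

Fixpoint eval (U : universe) (G : seq Type) (X : Type) (t : term G X)
    (e : env U G) : U X :=
  match t with
  | TVar _ v => lookup v e
  | TCst _ x => std U x
  | TApp _ _ f s => star_app f (eval s e)
  | TPair _ _ s s' => star_pair (eval s e) (eval s' e)
  end.

Fixpoint satisfies (U : universe) (G : seq Type) (phi : formula G) :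
    env U G -> Prop :=
  match phi with
  | FEq _ _ s t => fun e => eval s e = eval t e
  | FMem _ _ s t => fun e => star_mem (eval s e) (eval t e)
  | FNot _ p => fun e => ~ satisfies p e
  | FAnd _ p q => fun e => satisfies p e /\ satisfies q e
  | FOr _ p q => fun e => satisfies p e \/ satisfies q e
  | FImp _ p q => fun e => satisfies p e -> satisfies q e
  | FAll _ X p => fun e => forall x : U X, satisfies (U := U) p (x, e)
  | FEx _ X p => fun e => exists x : U X, satisfies (U := U) p (x, e)
  end.

Definition transfer (U : universe) : Prop := forall phi : formula [::],
  satisfies (U := standard_universe) phi tt <-> satisfies (U := U) phi tt.

Definition star_set (U : universe) (X : Type) (A : set X) : U X -> Prop :=
  fun x => star_mem x (std U A).

Definition enlarging (U : universe) : Prop := forall (X : Type) (F : set (set X)),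
  finI F id -> exists x : U X, forall A, F A -> star_set A x.

Record enlargement := Enlargement {
  star :> universe;
  star_transfer : transfer star;
  star_enlarging : enlarging star }.

Definition star_rel (U : universe) (X Y : Type) (P : X -> Y -> Prop)
    (x : U X) (y : U Y) : Prop :=
  star_set [set p : X * Y | P p.1 p.2] (star_pair x y).

Definition positive_infinitesimal (R : realType) (E : enlargement) (delta : E R) :
    Prop :=
  star_rel (fun x y : R => x < y) (std E 0) delta /\
  forall r : R, 0 < r -> star_rel (fun x y : R => x < y) delta (std E r).

(** * Germs

   A germ at 0 of a function defined near 0 is represented by total functions,
   which are identified when they agree on a neighbourhood of 0. *)

Section Germs.
Variables (R : realType) (n : nat).

Definition vanishing : {pred ('rV[R]_n -> R)} := fun f => f 0 == 0.

Lemma vanishing_zmod_closed : zmod_closed vanishing.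
Proof.
split=> [|f g]; rewrite !unfold_in /=; first by [].
by move=> /eqP f0 /eqP g0; rewrite /GRing.add /GRing.opp /= f0 g0 subrr.
Qed.

HB.instance Definition _ :=
  GRing.isZmodClosed.Build ('rV[R]_n -> R) vanishing vanishing_zmod_closed.

Record vfun := VFun {
  vfun_val :> 'rV[R]_n -> R;
  vfunP : vfun_val \in vanishing }.

HB.instance Definition _ := [isSub for vfun_val].
HB.instance Definition _ := [Choice of vfun by <:].
HB.instance Definition _ := [SubChoice_isSubZmodule of vfun by <:].

Definition null_near : {pred vfun} :=
  fun f => `[< \forall x \near (0 : 'rV[R]_n), f x = 0 >].

Lemma null_near_zmod_closed : zmod_closed null_near.
Proof.
split=> [|f g]; rewrite !unfold_in; first by apply/asboolP; near=> x.
move=> /asboolP f0 /asboolP g0; apply/asboolP; near=> x.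
rewrite [LHS](_ : _ = f x - g x) //.
by rewrite (near f0 x) ?(near g0 x) ?subrr //; near: x; assumption.
Unshelve. all: by end_near. Qed.

HB.instance Definition _ :=
  GRing.isZmodClosed.Build vfun null_near null_near_zmod_closed.

Definition germ : Type := Quotient.quot null_near.

HB.instance Definition _ := GRing.Zmodule.on germ.

Definition germ_of (f : vfun) : germ := \pi_(Quotient.quot null_near)%qT f.

Definition continuous_germs : set germ :=
  [set u | exists2 f : vfun, u = germ_of f &
    \forall x \near (0 : 'rV[R]_n), {for x, continuous (f : 'rV[R]_n -> R)}].

(* The Euclidean norm; the norm that the library puts on 'rV[R]_n is the sup
   norm. *)
Definition enorm (x : 'rV[R]_n) : R := Num.sqrt (\sum_i x 0 i ^+ 2).

(* Extended-real valued, as f may be unbounded near 0. *)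
Definition ball_norm (f : vfun) (r : R) : \bar R :=
  ereal_sup [set `|f x|%:E | x in [set x | enorm x <= r]].

End Germs.

(* The germs, to be topologised by the topology that depends on delta. *)
Definition tau_germ (R : realType) (E : enlargement) (delta : E R) (n : nat) :
  Type := germ R n.

Section Tau.
Variables (R : realType) (E : enlargement) (delta : E R).

(* R_+ is the set of positive reals. *)
Definition moduli : set (R -> R) :=
  [set m | [/\ forall t, 0 < t -> 0 < m t,
    m t @[t --> 0^'+] --> (0 : R) &
    exists2 e : R, 0 < e & forall r t, 0 < r -> r < t -> t < e -> m r < m t]].

Definition star_moduli : E R -> Prop :=
  fun r => exists2 m, moduli m & star_app m delta = r.

Variable n : nat.

Definition star_ball_norm (f : vfun R n) : E (\bar R) := star_app (ball_norm f) delta.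

Definition tau_ball (r : E R) : set (germ R n) :=
  [set germ_of f | f in
    [set f | star_rel (fun (x : \bar R) (y : R) => (x < y%:E)%E)
               (star_ball_norm f) r]].

Definition tau_subbase : set (set (germ R n)) :=
  [set A | exists2 r, star_moduli r & exists v, A = [set u + v | u in tau_ball r]].

HB.instance Definition _ := Choice.copy (tau_germ delta n) (germ R n).
HB.instance Definition _ :=
  isSubBaseTopological.Build (tau_germ delta n) tau_subbase id.

End Tau.

(** * Nets *)

Definition directed (D : Type) (le : D -> D -> Prop) : Prop :=
  [/\ inhabited D, forall d, le d d,
    forall a b c, le a b -> le b c -> le a c &
    forall a b, exists c, le a c /\ le b c].

Definition net_tails (D : Type) (le : D -> D -> Prop) : set_system D :=
  [set P | exists d0, forall d, le d0 d -> P d].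

Definition net_converges (T : topologicalType) (D : Type) (le : D -> D -> Prop)
    (f : D -> T) (g : T) : Prop :=
  f @ net_tails le --> g.

Arguments net_converges T [D] le f g.

(* Main.v *)
Require Import Defs.
From mathcomp Require Import all_boot all_order all_algebra.
From mathcomp Require Import all_classical all_reals all_analysis.
From mathcomp Require Import finmap lra.

(** Suppose g is not continuous near 0. Then every ball around 0 contains a point
    where g jumps, so the supremum J(r) of the sizes of the jumps of g in the open
    ball of radius r is positive for every r > 0, and it is nondecreasing in r.
    Neither strict growth nor convergence to 0 is automatic for J, but the factor
    r in m(r) = r J(r) / 4 (with jump sizes cut off at 1) forces both, and m is a
    modulus ([moduli_jump_modulus]).

    If c is continuous near 0 and |c - g| < m(r) on the ball of radius r, then by
    the triangle inequality g varies by less than 3 m(r) < J(r) around every point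
    of the open ball, while some point carries a jump larger than 3 m(r). Hence
    the sup norm of c - g on the ball of radius r is at least m(r) for all small
    r ([jump_modulus_le_ball_norm]).

    By transfer, this bound holds at delta, although only standard radii were
    considered: no germ of a continuous function lies in the translate to g of
    the ball of radius *m(delta) ([star_rel_frequently0]). As this translate is a
    neighbourhood of g ([nbhs_tau_ball]), the net has to enter it. The modulus
    depends on g but not on the continuous germ, and therefore one element of
    the net already gives the contradiction. *)

Set Implicit Arguments.
Unset Strict Implicit.
Unset Printing Implicit Defensive.

Import Order.TTheory GRing.Theory Num.Theory.
Import numFieldNormedType.Exports.

Local Open Scope classical_set_scope.
Local Open Scope ring_scope.

Section Transfer.
Variables (R : realType) (E : enlargement) (delta : E R).
Hypothesis hdelta : positive_infinitesimal delta.
Variables (X Y : Type) (P : X -> Y -> Prop) (a : R -> X) (b : R -> Y).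

Let x0 : term [:: (R : Type)] R := TVar (VarZ [::] (R : Type)).
Let lt_formula (s t : term [:: (R : Type)] R) : formula [:: (R : Type)] :=
  FMem (TPair s t) (TCst _ [set p : R * R | p.1 < p.2]).
Let rel_formula : formula [:: (R : Type)] :=
  FMem (TPair (TApp a x0) (TApp b x0)) (TCst _ [set p : X * Y | P p.1 p.2]).

(** What holds for all small standard radii holds at a positive infinitesimal:
    the bounded universal statement is transferred and instantiated at delta. *)
Lemma star_rel_near0 (e : R) : 0 < e ->
  (forall t, 0 < t -> t < e -> P (a t) (b t)) ->
  star_rel P (star_app a delta) (star_app b delta).
Proof.
move=> e0 H; have [d0 dlt] := hdelta.
have /(star_transfer E) := H : satisfies (U := standard_universe)
  (FAll (FImp (lt_formula (TCst _ (0 : R)) x0)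
     (FImp (lt_formula x0 (TCst _ e)) rel_formula))) tt.
by move=> /(_ delta d0 (dlt _ e0)).
Qed.

(** Conversely, delta itself is a witness in the extension of an existential
    statement, whose transfer yields standard witnesses, arbitrarily small since
    delta lies below every standard e > 0. *)
Lemma star_rel_frequently0 (e : R) : 0 < e ->
  star_rel P (star_app a delta) (star_app b delta) ->
  exists t, [/\ 0 < t, t < e & P (a t) (b t)].
Proof.
move=> e0 H; have [d0 dlt] := hdelta.
suff /(star_transfer E) [t [t0 [te Pt]]] : satisfies (U := E)
  (FEx (FAnd (lt_formula (TCst _ (0 : R)) x0)
     (FAnd (lt_formula x0 (TCst _ e)) rel_formula))) tt by exists t.
by exists delta; split; [exact: d0 | split; [exact: dlt | exact: H]].
Qed.

End Transfer.

Section EuclideanNorm.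
Variables (R : realType) (n : nat).

Lemma enorm_continuous : continuous (@enorm R n).
Proof.
move=> x; apply: (continuous_comp _ (@sqrt_continuous R _)) => //.
apply: continuous_big; first exact: add_continuous.
move=> i _ y; apply: (continuous_comp (g := fun t : R => t ^+ 2)).
  exact: coord_continuous.
exact: exprn_continuous.
Qed.

Lemma enorm0 : enorm (0 : 'rV[R]_n) = 0.
Proof.
by rewrite /enorm big1 ?sqrtr0 // => i _; rewrite mxE expr0n.
Qed.

Lemma near_enorm_lt (x : 'rV[R]_n) (r : R) :
  enorm x < r -> \forall y \near x, enorm y < r.
Proof. by move=> xr; exact: (enorm_continuous (lt_nbhsl xr)). Qed.

Lemma coord_le_enorm (x : 'rV[R]_n) i : `|x 0 i| <= enorm x.
Proof.
rewrite -sqrtr_sqr /enorm ler_wsqrtr // (bigD1 i) //= lerDl.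
by apply: sumr_ge0 => j _; exact: sqr_ge0.
Qed.

(** The neighbourhood filter comes from the sup norm, which is dominated by the
    Euclidean norm; this is the half of the equivalence of norms that turns
    neighbourhoods of 0 into Euclidean balls. *)
Lemma near0_enormP (P : set 'rV[R]_n) : (\forall x \near (0 : 'rV[R]_n), P x) ->
  exists2 r : R, 0 < r & forall x, enorm x < r -> P x.
Proof.
move=> /nbhs_ballP[r /= r0 rP]; exists r => // x xr; apply: rP.
split=> // i j; rewrite ord1 /ball /= mxE sub0r normrN.
exact: le_lt_trans (coord_le_enorm x j) xr.
Qed.

End EuclideanNorm.

Section Jumps.
Variables (R : realType) (n : nat) (g : 'rV[R]_n -> R).

(** The bound by 1 keeps suprema finite when g is unbounded near 0. The ball is
    open so that a neighbourhood of each of its points stays in the closed ball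
    on which [ball_norm] takes its supremum. *)
Definition jumps (r : R) : set R :=
  [set e | 0 < e <= 1 /\
    exists2 x, enorm x < r & ~ \forall y \near x, `|g y - g x| < e].

Definition jump_modulus (r : R) : R := r * sup (jumps r) / 4.

Hypothesis g_discont : ~ \forall x \near (0 : 'rV[R]_n), {for x, continuous g}.

Lemma jumps_neq0 r : 0 < r -> jumps r !=set0.
Proof.
move=> r0; apply: contrapT => J0; apply: g_discont.
have : \forall x \near (0 : 'rV[R]_n), enorm x < r.
  by apply: near_enorm_lt; rewrite enorm0.
apply: filterS => x xr; apply/(@cvgrPdist_lt _ _ _ (nbhs x)) => e e0.
apply: contrapT => Hx; apply: J0; exists (Num.min e 1); split.
  by rewrite lt_min e0 ltr01 ge_min lexx orbT.
exists x => // H; apply: Hx; apply: filterS H => y.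
by rewrite distrC lt_min => /andP[].
Qed.

Lemma has_ubound_jumps r : has_ubound (jumps r).
Proof. by exists 1 => e [/andP[]]. Qed.

Lemma sup_jumps_gt0 r : 0 < r -> 0 < sup (jumps r).
Proof.
move=> /jumps_neq0[e Je]; have [/andP[e0 _] _] := Je.
exact: lt_le_trans e0 (ub_le_sup (has_ubound_jumps r) Je).
Qed.

Lemma sup_jumps_le1 r : 0 < r -> sup (jumps r) <= 1.
Proof. by move=> /jumps_neq0 J0; apply: ge_sup => // e [/andP[]]. Qed.

Lemma le_sup_jumps r t : 0 < r -> r <= t -> sup (jumps r) <= sup (jumps t).
Proof.
move=> r0 rt; apply: ge_sup; first exact: jumps_neq0.
move=> e [e01 [x xr xe]]; apply: ub_le_sup; first exact: has_ubound_jumps.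
by split=> //; exists x => //; exact: lt_le_trans xr rt.
Qed.

(** The sup of the jumps lies between 0 and 1 and is nondecreasing, so the factor
    r provides both the limit 0 and the strict growth. *)
Lemma moduli_jump_modulus : moduli jump_modulus.
Proof.
split.
- by move=> t t0; rewrite divr_gt0 ?mulr_gt0 ?sup_jumps_gt0.
- apply: (@squeeze_cvgr _ _ _ _ (cst 0) id); last 2 first.
  + exact: cvg_cst.
  + exact: cvg_at_right_filter.
  near=> t; have t0 : 0 < t by near: t; exact: nbhs_right_gt.
  have := sup_jumps_gt0 t0; have := sup_jumps_le1 t0.
  rewrite /jump_modulus /=; nra.
- exists 1 => // r t r0 rt _; have t0 := lt_trans r0 rt.
  rewrite /jump_modulus ltr_pM2r ?invr_gt0 //.
  apply: (@lt_le_trans _ _ (t * sup (jumps r))).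
    by rewrite ltr_pM2r ?sup_jumps_gt0.
  by rewrite ler_pM2l // le_sup_jumps // ltW.
Unshelve. all: by end_near.
Qed.

(** With c = h + g continuous, |g y - g x| is at most |c y - c x| + |h y| + |h x|,
    and for y close to x each of the three terms is below the modulus, whereas
    some x in the open ball has a jump of more than three times the modulus. *)
Lemma jump_modulus_le_ball_norm (h : vfun R n) (e : R) :
  (forall x, enorm x < e -> {for x, continuous (fun y => h y + g y)}) ->
  forall r, 0 < r -> r < e -> r < 1 ->
  ~ (ball_norm h r < (jump_modulus r)%:E)%E.
Proof.
move=> c_cont r r0 re r1 hlt.
have h_lt x : enorm x <= r -> `|h x| < jump_modulus r.
  move=> xr; rewrite -lte_fin; apply: le_lt_trans hlt.
  by apply: ereal_sup_ubound; exists x.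
(* This is where r < 1 and the denominator 4 > 3 of the modulus enter. *)
have : 3 * jump_modulus r < sup (jumps r).
  by have := sup_jumps_gt0 r0; rewrite /jump_modulus; nra.
move=> /(sup_gt (jumps_neq0 r0))[k [_ [x xr xk]] mk].
have m0 : 0 < jump_modulus r by rewrite divr_gt0 ?mulr_gt0 ?sup_jumps_gt0.
apply: xk.
have /cvgrPdist_lt/(_ _ m0) := c_cont x (lt_trans xr re).
apply: filterS2 (near_enorm_lt xr) => y /ltW/h_lt.
move: (h_lt x (ltW xr)); rewrite !ltr_norml => /andP[? ?] /andP[? ?] /andP[? ?].
by apply/andP; split; lra.
Qed.

End Jumps.

Lemma germ_of_eq_near (R : realType) (n : nat) (f g : vfun R n) :
  germ_of f = germ_of g -> \forall x \near (0 : 'rV[R]_n), f x = g x.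
Proof.
move=> /eqP; rewrite -Quotient.idealrBE unfold_in => /asboolP.
by apply: filterS => x fgx; apply/eqP; rewrite -subr_eq0; apply/eqP.
Qed.

Lemma germ_ofD (R : realType) (n : nat) (f g : vfun R n) :
  germ_of (f + g) = germ_of f + germ_of g.
Proof. exact: Quotient.pi_add. Qed.

Lemma germ_of_surj (R : realType) (n : nat) (u : germ R n) :
  exists f, u = germ_of f.
Proof. by exists (generic_quotient.repr u); rewrite /germ_of generic_quotient.reprK. Qed.

(** Two functions that agree near 0 agree, for every x near 0, on a neighbourhood
    of x, so continuity near 0 does not depend on the representative. *)
Lemma continuous_germsP (R : realType) (n : nat) (f : vfun R n) :
  continuous_germs (germ_of f) <->
  \forall x \near (0 : 'rV[R]_n), {for x, continuous f}.
Proof.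
split; last by exists f.
move=> [c /germ_of_eq_near /near_join fc c_cont].
apply: filterS2 fc c_cont => x fc cx.
have fcx : f x = c x := nbhs_singleton fc.
rewrite /prop_for /continuous_at fcx; apply: cvg_trans cx.
by apply: (@near_eq_cvg _ _ (nbhs x)); apply: filterS fc => y ->.
Qed.

Section Tau.
Variables (R : realType) (E : enlargement) (delta : E R) (n : nat).
Hypothesis hdelta : positive_infinitesimal delta.

(** The translate belongs to the subbase; it contains g because moduli take
    positive values, hence *m(delta) exceeds the norm 0 of the zero germ. *)
Lemma nbhs_tau_ball (m : R -> R) (g : germ R n) : moduli m ->
  nbhs (g : tau_germ delta n)
    [set u + g | u in tau_ball delta (star_app m delta)].
Proof.
move=> m_mod; apply: open_nbhs_nbhs; split; last first.
  exists 0; last by rewrite add0r.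
  exists 0; last by apply: (addrI (germ_of 0)); rewrite -germ_ofD !addr0.
  apply: (star_rel_near0 hdelta ltr01) => t t0 _.
  have [m_gt0 _ _] := m_mod.
  apply: (@le_lt_trans _ _ 0%E); last by rewrite lte_fin m_gt0.
  by apply: ge_ereal_sup => _ [x _ <-]; rewrite normr0.
set S := [set _ | _ in _].
exists [set S]; last by rewrite bigcup_set1.
move=> _ ->; exists [fset S]%fset; last by rewrite set_fset1 bigcap_set1.
move=> _ /fset1P ->; apply: mem_set; exists (star_app m delta); first by exists m.
by exists g.
Qed.

End Tau.

Theorem theorem3p1 (R : realType) (E : enlargement) (n : nat) (delta : E R)
  (hdelta : positive_infinitesimal delta)
  (D : Type) (le : D -> D -> Prop) (hD : directed le)
  (f : D -> germ R n) (hf : forall d, continuous_germs (f d))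
  (g : germ R n)
  (hfg : net_converges (tau_germ delta n) le f g) :
  continuous_germs g.
Proof.
have [g0 g0E] := germ_of_surj g.
apply: contrapT => gNc.
have g_discont : ~ \forall x \near (0 : 'rV[R]_n), {for x, continuous g0}.
  by move=> /continuous_germsP; rewrite -g0E.
have [d0 fd0] := hfg _ (nbhs_tau_ball hdelta g (moduli_jump_modulus g_discont)).
have [_ le_refl _ _] := hD.
have [_ [h hlt <-] fE] := fd0 d0 (le_refl d0).
have := hf d0; rewrite -fE g0E -germ_ofD => /continuous_germsP.
move=> /near0_enormP[e e0 c_cont].
have me : 0 < Num.min e 1 by rewrite lt_min e0 ltr01.
have [r [r0]] := star_rel_frequently0 hdelta me hlt.
rewrite lt_min => /andP[re r1].
exact: (jump_modulus_le_ball_norm g_discont c_cont r0 re r1).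
Qed.
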